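(* Let $G$ be a finite, connected Ramanujan graph on $N\ge 3$ vertices of degree $d$, with non-negative resistance curvature, where $d\ge 4(\log N)^{2/3}$. Then $$\operatorname{diam}(G)\;\le\;1+\frac{3\,\log N}{\log(\log N)}.$$
   Context: Graphs are finite, simple, undirected and unweighted; $\log$ is the natural logarithm. A Ramanujan graph of degree $d$ is a finite connected $d$-regular graph such that every eigenvalue $\mu$ of its adjacency matrix other than the trivial (simple) eigenvalue $d$ satisfies $|\mu|\le 2\sqrt{d-1}$. For a vertex $v$ with neighbor set $\mathcal N(v)$, the resistance curvature is $$p(v)=1-\frac12\sum_{u\in\mathcal N(v)}R_{\mathrm{eff}}(v,u),$$ where $R_{\mathrm{eff}}(v,u)$ is the effective resistance between $v$ and $u$ when every edge is a unit resistor. $G$ has non-negative resistance curvature if $p(v)\ge 0$ for every vertex $v$. The diameter $\operatorname{diam}(G)$ is the maximum over pairs of vertices of the length of a shortest path between them. *)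

(* Defs.v *)
From mathcomp Require Import all_boot all_order all_algebra.
From mathcomp Require Import reals exp.

Set Implicit Arguments.
Unset Strict Implicit.
Unset Printing Implicit Defensive.

Import Order.TTheory GRing.Theory Num.Theory.

Local Open Scope ring_scope.

(* A finite simple graph is a symmetric irreflexive relation [e] on a finite
   type [V] of vertices. Matrices are indexed by ['I_#|V|], through the
   enumeration of [V]. *)

Section Graph.
Variables (V : finType) (e : rel V).

Definition graph_connected : Prop := forall u v : V, connect e u v.

Definition degree (v : V) : nat := #|[set u | e v u]|.

Definition regular (d : nat) : Prop := forall v : V, degree v = d.

Definition has_path (u v : V) (n : nat) : bool :=
  [exists p : n.-tuple V,
     [&& path e u p, uniq (u :: p) & last u p == v]].

(* A path without repeated vertices has fewer than [#|V|] edges; the value is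
   [#|V|] when [u] and [v] are not connected. *)
Definition dist (u v : V) : nat := find (has_path u v) (iota 0 #|V|).

Definition diam : nat := \max_(u : V) \max_(v : V) dist u v.

Section Matrices.
Variable R : realType.

Definition adjacency : 'M[R]_#|V| :=
  \matrix_(i, j) (e (enum_val i) (enum_val j))%:R.

Definition laplacian : 'M[R]_#|V| :=
  diag_mx (\row_i (degree (enum_val i))%:R) - adjacency.

(* The adjacency matrix is real symmetric, so its eigenvalues are all in [R].
   The eigenvalue [d] is automatically simple, by connectedness. *)
Definition ramanujan (d : nat) : Prop :=
  [/\ graph_connected, regular d &
      forall mu : R, eigenvalue adjacency mu -> mu != d%:R ->
        `|mu| <= 2 * Num.sqrt (d%:R - 1)].

Definition unit_current (u v : V) : 'rV[R]_#|V| :=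
  delta_mx 0 (enum_rank u) - delta_mx 0 (enum_rank v).

(* By Kirchhoff's and Ohm's laws, [phi] is the potential created by a unit
   current entering at [u] and leaving at [v] when
   [phi *m laplacian = unit_current u v]; [pinvmx] provides such a [phi]
   whenever one exists, as is the case in a connected graph. The effective
   resistance is the resulting potential drop, which by [eff_resistanceE] does
   not depend on the chosen solution. *)
Definition potential (u v : V) : 'rV[R]_#|V| :=
  unit_current u v *m pinvmx laplacian.

Definition eff_resistance (u v : V) : R :=
  potential u v 0 (enum_rank u) - potential u v 0 (enum_rank v).

Definition resistance_curvature (v : V) : R :=
  1 - 2^-1 * \sum_(u | e v u) eff_resistance v u.

Hypothesis e_sym : symmetric e.

Lemma laplacian_sym : laplacian^T = laplacian.
Proof.
rewrite linearB /= tr_diag_mx; congr (_ - _).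
by apply/matrixP=> i j; rewrite !mxE e_sym.
Qed.

Lemma eff_resistanceE (u v : V) (phi : 'rV[R]_#|V|) :
  phi *m laplacian = unit_current u v ->
  eff_resistance u v = phi 0 (enum_rank u) - phi 0 (enum_rank v).
Proof.
move=> phiL.
have dropE (psi : 'rV[R]_#|V|) : psi 0 (enum_rank u) - psi 0 (enum_rank v) =
    (psi *m (unit_current u v)^T) 0 0.
  by rewrite linearB mulmxBr /= !trmx_delta -!colE !mxE.
have potL : potential u v *m laplacian = unit_current u v.
  by rewrite mulmxKpV // -phiL submxMl.
rewrite /eff_resistance !dropE -{1}phiL trmx_mul laplacian_sym mulmxA potL.
by rewrite -[in RHS](trmxK phi) -trmx_mul [RHS]mxE.
Qed.

End Matrices.
End Graph.

(* Main.v *)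
(* By the spectral theorem, the adjacency matrix [A] of a connected [d]-regular
   graph on [N] vertices, all of whose nontrivial eigenvalues have absolute
   value at most [lam], satisfies [|(A ^ k) u v - d ^ k / N| <= lam ^ k]; hence
   every two vertices are joined by a walk of length [k] as soon as
   [(d / lam) ^ k > N].  For [lam = 2 sqrt (d - 1)] the lower bound on [d] gives
   [d / lam >= (log N) ^ (1 / 3)], and any [k > 3 log N / log (log N)] works. *)
Require Import Defs.
From mathcomp Require Import all_boot all_order all_algebra.
From mathcomp Require Import ring lra complex reals sequences exp.

Set Implicit Arguments.
Unset Strict Implicit.
Unset Printing Implicit Defensive.

Import Order.TTheory GRing.Theory Num.Theory.

Local Open Scope ring_scope.

(** * Spectral bound for the powers of a real symmetric matrix *)

Section Spectral.
Local Open Scope sesquilinear_scope.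

(** As [B] is real, multiplying by it does not mix real and imaginary parts; this and the next lemma
    split a complex eigenvector of a real matrix into two real ones. *)
Lemma map_Re_mulmx (R : rcfType) m n p
    (w : 'M[R[i]]_(m, n)) (B : 'M[R]_(n, p)) :
  map_mx (@complex.Re R) (w *m map_mx (real_complex R) B) =
  map_mx (@complex.Re R) w *m B.
Proof.
have ReD : {morph @complex.Re R : x y / x + y} by move=> [? ?] [? ?].
apply/matrixP=> i j; rewrite !mxE (big_morph _ ReD (erefl : complex.Re 0 = 0)).
apply: eq_bigr => k _; rewrite !mxE; case: (w i k) => a b /=.
by rewrite mulr0 subr0.
Qed.

Lemma map_Im_mulmx (R : rcfType) m n p
    (w : 'M[R[i]]_(m, n)) (B : 'M[R]_(n, p)) :
  map_mx (@complex.Im R) (w *m map_mx (real_complex R) B) =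
  map_mx (@complex.Im R) w *m B.
Proof.
have ImD : {morph @complex.Im R : x y / x + y} by move=> [? ?] [? ?].
apply/matrixP=> i j; rewrite !mxE (big_morph _ ImD (erefl : complex.Im 0 = 0)).
apply: eq_bigr => k _; rewrite !mxE; case: (w i k) => a b /=.
by rewrite mulr0 add0r.
Qed.

Lemma spectralmx_mul (C : numClosedFieldType) n (A : 'M[C]_n) :
  A \is normalmx ->
  spectralmx A *m A = diag_mx (spectral_diag A) *m spectralmx A.
Proof.
move=> /orthomx_spectralP {2}->.
by rewrite -mulmxA mulKVmx ?spectral_unit.
Qed.

Lemma map_real_complex_mxOver (R : rcfType) m n (A : 'M[R]_(m, n)) :
  map_mx (real_complex R) A \is a mxOver Num.real.
Proof.
by apply/mxOverP=> i j; rewrite mxE; apply/complex_realP; exists (A i j).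
Qed.

(** In a unitary eigenbasis the form is the sum of the [D_j ^+ k * c_x(j) * conj (c_y(j))].
    Eigenvalues larger than [lam] drop out, since [x] is orthogonal to their eigenvectors; for the
    others the arithmetic-geometric mean inequality bounds [|c_x(j)| * |c_y(j)|]. *)
Lemma sym_pow_form_bound (R : rcfType) n (A : 'M[R]_n) (x y : 'rV[R]_n)
    (lam : R) k :
  A^T = A -> 0 <= lam ->
  (forall (mu : R) (v : 'rV[R]_n), v *m A = mu *: v ->
     `|mu| <= lam \/ v *m x^T = 0) ->
  `|(x *m A ^+ k *m y^T) 0 0| <=
    lam ^+ k * (((x *m x^T) 0 0 + (y *m y^T) 0 0) / 2).
Proof.
move=> Asym lam0 eigA.
pose f := real_complex R.
pose A' := map_mx f A.
have A'real : A' \is a mxOver Num.real by apply: map_real_complex_mxOver.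
have A'sym : A'^T = A' by rewrite map_trmx Asym.
have A'herm : A' \is hermsymmx.
  by apply/is_hermitianmxP; rewrite expr0 scale1r A'sym realmxC.
have A'norm := hermitian_normalmx A'herm.
have spE := spectralmx_mul A'norm.
have Dreal := hermitian_spectral_diag_real A'herm.
have Punit := spectral_unitarymx A'.
move: spE Dreal Punit; set P := spectralmx A'; set D := spectral_diag A'.
move=> spE Dreal Punit.
have PP : P^t* *m P = 1%:M by rewrite -invmx_unitary // mulVmx ?spectral_unit.
(* The coordinates of [z] in the orthonormal basis formed by the rows of [P]. *)
pose c (z : 'rV[R]_n) := map_mx f z *m P^t*.
have powE : P *m map_mx f (A ^+ k) = diag_mx (\row_j (D 0 j ^+ k)) *m P.
  elim: k => [|k IH].
    rewrite expr0 map_mx1 mulmx1; apply/matrixP=> i j.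
    by rewrite mul_diag_mx !mxE expr0 mul1r.
  rewrite exprSr map_mxM mulmxA IH -mulmxA spE mulmxA mulmx_diag.
  by congr (diag_mx _ *m _); apply/rowP=> j; rewrite !mxE exprSr.
(* Kept general in [B]: powers of [A] give the form to be bounded, and the identity gives Parseval's
   formula [sqE]. *)
have formE (z t : 'rV[R]_n) (B : 'M[R]_n) (B' : 'M[R[i]]_n) :
    P *m map_mx f B = B' *m P ->
  f ((z *m B *m t^T) 0 0) = (c z *m B' *m (c t)^t*) 0 0.
  move=> PB.
  have -> : (c t)^t* = P *m map_mx f t^T.
    rewrite /c trmx_mul map_mxM trmxCK map_trmx; congr (_ *m _).
    by rewrite realmxC ?map_real_complex_mxOver.
  rewrite -[RHS]/((_ *m _) 0 0) mulmxA -[c z *m B' *m P]mulmxA -PB /c.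
  rewrite mulmxA -[_ *m P^t* *m P]mulmxA PP mulmx1.
  by rewrite -!map_mxM [RHS]mxE.
(* For a real matrix and a real eigenvalue, the real and imaginary parts of an
   eigenvector are eigenvectors. *)
have cterm0 j : `|D 0 j| <= f lam \/ c x 0 j = 0.
  have /complex_realP [mu Dj] : D 0 j \is Num.real by apply: (mxOverP Dreal).
  have rowE : row j P *m A' = D 0 j *: row j P.
    rewrite -row_mul spE; apply/rowP=> l.
    by rewrite [in RHS]mxE mxE mul_diag_mx !mxE.
  have real_row (v : 'rV[R]_n) :
      v *m A = mu *: v -> `|D 0 j| <= f lam \/ v *m x^T = 0.
    move=> /eigA[mu_le|]; [left|by right].
    by rewrite Dj normc_def /= expr0n addr0 sqrtr_sqr lecR.
  have ReZ (v : 'rV[R[i]]_n) :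
      map_mx (@complex.Re R) (f mu *: v) = mu *: map_mx (@complex.Re R) v.
    apply/rowP=> i; rewrite !mxE; case: (v 0 i) => a b /=.
    by rewrite mul0r subr0.
  have ImZ (v : 'rV[R[i]]_n) :
      map_mx (@complex.Im R) (f mu *: v) = mu *: map_mx (@complex.Im R) v.
    apply/rowP=> i; rewrite !mxE; case: (v 0 i) => a b /=.
    by rewrite mul0r addr0.
  have /real_row[|Re0] : map_mx (@complex.Re R) (row j P) *m A =
      mu *: map_mx (@complex.Re R) (row j P).
  - by rewrite -map_Re_mulmx rowE Dj ReZ.
  - by left.
  have /real_row[|Im0] : map_mx (@complex.Im R) (row j P) *m A =
      mu *: map_mx (@complex.Im R) (row j P).
  - by rewrite -map_Im_mulmx rowE Dj ImZ.
  - by left.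
  right; have Px0 : row j P *m (map_mx f x)^T = 0.
    rewrite map_trmx; apply/matrixP=> a b; rewrite mxE.
    move: Re0 Im0; rewrite -map_Re_mulmx -map_Im_mulmx.
    move=> /matrixP/(_ a b) + /matrixP/(_ a b).
    by rewrite !mxE; case: (\sum_i _) => p q /= -> ->.
  (* Since [x] is real, conjugating the row of [P] conjugates the whole product. *)
  have : c x 0 j = ((row j P *m (map_mx f x)^T) 0 0)^*.
    rewrite /c !mxE rmorph_sum; apply: eq_bigr => i _.
    rewrite !mxE rmorphM mulrC.
    by congr (_ * _); apply/esym/CrealP/complex_realP; exists (x 0 i).
  by move=> ->; rewrite Px0 mxE conjC0.
have sqE (z : 'rV[R]_n) : f ((z *m z^T) 0 0) = \sum_j `|c z 0 j| ^+ 2.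
  have := formE z z 1%:M 1%:M; rewrite map_mx1 !mulmx1 mul1mx.
  move=> /(_ erefl) ->; rewrite mxE; apply: eq_bigr => j _.
  by rewrite !mxE normCK.
have fnorm (r : R) : f `|r| = `|f r|.
  by rewrite normc_def /= expr0n addr0 sqrtr_sqr.
have fE a b : f (lam ^+ k * ((a + b) / 2)) = f lam ^+ k / 2 * (f a + f b).
  by rewrite /f !rmorphM rmorphXn rmorphD fmorphV rmorph_nat mulrA mulrAC.
rewrite -lecR -/f fnorm (formE _ _ _ _ powE) -mulmxA mxE fE !sqE.
rewrite -big_split mulr_sumr.
apply: le_trans (ler_norm_sum _ _ _) _.
apply: ler_sum => j _ /=.
have -> : (diag_mx (\row_j0 D 0 j0 ^+ k) *m c y ^t*) j 0 =
    D 0 j ^+ k * (c y 0 j)^*.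
  by rewrite mul_diag_mx !mxE.
rewrite !normrM normrX norm_conjC.
have [Dle|->] := cterm0 j; last first.
  rewrite normr0 mul0r expr0n /= add0r.
  by rewrite mulr_ge0 ?exprn_ge0 // divr_ge0 ?exprn_ge0 // ler0c.
have f_lam0 : 0 <= f lam by rewrite ler0c.
have Dk_le : `|D 0 j| ^+ k <= f lam ^+ k by rewrite lerXn2r ?nnegrE.
rewrite mulrCA -mulrA; apply: ler_pM; rewrite ?exprn_ge0 ?mulr_ge0 //.
rewrite [X in _ <= X]mulrC.
by apply: (real_leif_mean_square _ _).1; rewrite normr_real.
Qed.

End Spectral.

(** * Walks, distances and the adjacency matrix of a regular graph *)

Lemma trmx_exp (R : comPzRingType) n (A : 'M[R]_n) k : (A ^+ k)^T = A^T ^+ k.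
Proof.
elim: k => [|k IH]; first exact: trmx1.
by rewrite exprS exprSr trmx_mul IH.
Qed.

(** Removing repetitions from a walk leaves a path with fewer than [#|V|] edges, so its length lies
    in the range searched by [dist]. *)
Lemma path_dist_le (V : finType) (e : rel V) (u : V) (p : seq V) :
  path e u p -> (dist e u (last u p) <= size p)%N.
Proof.
move=> /shortenP[p' path_p' uniq_p' sub_p'].
have le_p' : (size p' <= size p)%N.
  by apply: uniq_leq_size => //; case/andP: uniq_p'.
have lt_p'V : (size p' < #|V|)%N.
  by rewrite -[(size p').+1]/(size (u :: p')) -(card_uniqP uniq_p') max_card.
apply: leq_trans le_p'; rewrite leqNgt; apply/negP => lt_dist.
have := before_find 0%N lt_dist; rewrite nth_iota // add0n => /existsP[].
by exists (in_tuple p'); rewrite path_p' uniq_p' eqxx.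
Qed.

Section Adjacency.
Variables (R : realType) (V : finType) (e : rel V).
Local Notation A := (adjacency e R).

Lemma adjacency_sym : symmetric e -> A^T = A.
Proof. by move=> e_sym; apply/matrixP=> i j; rewrite !mxE e_sym. Qed.

Lemma sum_adjacency (j : 'I_#|V|) (F : 'I_#|V| -> R) :
  \sum_i F i * A i j = \sum_(v | e v (enum_val j)) F (enum_rank v).
Proof.
rewrite (reindex_onto enum_rank enum_val) /=; last first.
  by move=> i _; exact: enum_valK.
under eq_bigl do rewrite enum_rankK eqxx.
rewrite [RHS]big_mkcond /=; apply: eq_bigr => v _.
by rewrite mxE enum_rankK; case: ifP; rewrite ?mulr1 ?mulr0.
Qed.

(** The entry counts walks of length [k], but only its support matters: a nonzero sum has a nonzero
    term, which yields the last edge of a walk. *)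
Lemma adjacency_exp_walk k u v : (A ^+ k) (enum_rank u) (enum_rank v) != 0 ->
  exists p, [/\ path e u p, last u p = v & size p = k].
Proof.
elim: k v => [|k IH] v.
  rewrite expr0 mxE; have [/enum_rank_inj -> _|] := eqVneq (enum_rank u).
    by exists [::].
  by rewrite eqxx.
rewrite exprSr mxE => nz.
have [w Aw] : exists w, (A ^+ k) (enum_rank u) w * A w (enum_rank v) != 0.
  apply/existsP; apply: contraNT nz; rewrite negb_exists => /forallP z.
  by rewrite big1 // => i _; apply/eqP; move: (z i); rewrite negbK.
move: Aw; rewrite mulf_eq0 negb_or -[w]enum_valK => /andP[/IH[p [pp lp sp]]].
rewrite mxE !enum_rankK => ew; exists (rcons p v).
rewrite last_rcons size_rcons sp rcons_path pp lp; split=> //=.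
by move: ew; case: (e _ _); rewrite ?eqxx.
Qed.

Section Regular.
Variable d : nat.
Hypotheses (e_sym : symmetric e) (e_reg : regular e d).

Lemma const_adjacency (a : R) : const_mx a *m A = d%:R *: const_mx a :> 'rV_ _.
Proof.
apply/rowP=> j; rewrite mxE.
under eq_bigr do rewrite mxE.
rewrite sum_adjacency !mxE sumr_const -[LHS]mulr_natl; congr (_%:R * _).
by rewrite -(e_reg (enum_val j)); apply: eq_card => v; rewrite !inE e_sym.
Qed.

Lemma const_adjacency_exp (a : R) k :
  const_mx a *m A ^+ k = d%:R ^+ k *: const_mx a :> 'rV_ _.
Proof.
elim: k => [|k IH]; first by rewrite mulmx1 scale1r.
by rewrite exprSr mulmxA IH -scalemxAl const_adjacency scalerA exprSr.
Qed.

(* The Dirichlet form [\sum_(u ~ v) (x_u - x_v)^2] of such an [x] vanishes. *)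
Lemma adjacency_eigen_const (x : 'rV[R]_#|V|) : graph_connected e ->
  x *m A = d%:R *: x -> exists a, x = const_mx a.
Proof.
move=> e_conn xA.
pose f v := x 0 (enum_rank v).
have sumf v : \sum_(u | e u v) f u = d%:R * f v.
  have /rowP/(_ (enum_rank v)) := xA.
  by rewrite mxE sum_adjacency enum_rankK mxE.
have energy : \sum_v \sum_(u | e u v) (f u - f v) ^+ 2 = 0.
  (* Double counting: each [f u ^+ 2] occurs once for every neighbour of [u]. *)
  have sumsq : \sum_v \sum_(u | e u v) f u ^+ 2 = d%:R * \sum_v f v ^+ 2.
    rewrite (exchange_big_dep predT) //= mulr_sumr; apply: eq_bigr => u _.
    rewrite sumr_const -[LHS]mulr_natl; congr (_%:R * _).
    by rewrite -(e_reg u); apply: eq_card => v; rewrite !inE.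
  have -> : \sum_v \sum_(u | e u v) (f u - f v) ^+ 2 =
      \sum_v \sum_(u | e u v) f u ^+ 2 - d%:R * \sum_v f v ^+ 2.
    rewrite mulr_sumr -sumrB; apply: eq_bigr => v _.
    transitivity (\sum_(u | e u v) (f u ^+ 2 + (f v ^+ 2 - 2 * f v * f u))).
      by apply: eq_bigr => u _; ring.
    rewrite big_split /= sumrB sumr_const.
    have -> : \sum_(u | e u v) 2 * f v * f u = 2 * f v * (d%:R * f v).
      by rewrite -mulr_sumr sumf.
    have -> : #|[pred u | e u v]| = d.
      by rewrite -(e_reg v); apply: eq_card => u; rewrite !inE e_sym.
    by rewrite -mulr_natl; ring.
  by rewrite sumsq subrr.
have f_edge u v : e u v -> f u = f v.
  move=> euv; move: energy.
  have sq_ge0 w z : 0 <= (f w - f z) ^+ 2 by exact: sqr_ge0.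
  move/psumr_eq0P => /(_ (fun w _ => sumr_ge0 _ (fun z _ => sq_ge0 z w))).
  move=> /(_ v isT)/psumr_eq0P => /(_ (fun w _ => sq_ge0 w v))/(_ u euv).
  by move/eqP; rewrite sqrf_eq0 subr_eq0 => /eqP.
have f_conn u v : f u = f v.
  have /connectP[p pp ->] := e_conn u v.
  by elim: p u pp => //= w p IH u /andP[/f_edge-> /IH].
(* On an empty vertex set any constant will do. *)
have [i _|V0] := pickP 'I_#|V|; last by exists 0; apply/rowP => j; have := V0 j.
exists (x 0 i); apply/rowP => j; rewrite mxE.
by have := f_conn (enum_val j) (enum_val i); rewrite /f !enum_valK.
Qed.

End Regular.
End Adjacency.

(** * From a bound on the nontrivial eigenvalues to a bound on the diameter *)

Lemma diam_le (R : realType) (V : finType) (e : rel V) (d : nat) (lam : R) k :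
  symmetric e -> graph_connected e -> regular e d -> 0 <= lam ->
  (forall mu : R, eigenvalue (adjacency e R) mu -> mu != d%:R ->
     `|mu| <= lam) ->
  lam ^+ k * #|V|%:R < d%:R ^+ k -> (diam e <= k)%N.
Proof.
move=> e_sym e_conn e_reg lam0 eigA ltk.
apply/bigmax_leqP => u _; apply/bigmax_leqP => v _.
rewrite leqNgt; apply/negP => k_lt.
set A := adjacency e R in eigA *.
have A_uv : (A ^+ k) (enum_rank u) (enum_rank v) = 0.
  apply/eqP/negPn/negP => /adjacency_exp_walk[p [pp lp sp]].
  by have := path_dist_le pp; rewrite lp sp leqNgt k_lt.
have A_sym : A^T = A by apply: adjacency_sym.
set N : R := #|V|%:R in ltk.
have N_gt0 : 0 < N by rewrite ltr0n; apply/card_gt0P; exists u.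
pose c : 'rV[R]_#|V| := const_mx N^-1.
(* The projection of the basis vector of [w] onto the orthogonal complement of the constants; its
   squared norm is [1 - N^-1]. *)
pose x w : 'rV[R]_#|V| := delta_mx 0 (enum_rank w) - c.
have deltaE (y : 'rV[R]_#|V|) w :
    (y *m (delta_mx 0 (enum_rank w) : 'rV_ _)^T) 0 0 = y 0 (enum_rank w).
  by rewrite trmx_delta -colE mxE.
have x_const w a : (const_mx a : 'rV_#|V|) *m (x w)^T = 0.
  apply/matrixP => i j; rewrite !ord1 linearB /= mulmxBr mxE deltaE !mxE.
  under eq_bigr do rewrite !mxE.
  rewrite sumr_const card_ord -[_ *+ _]mulr_natr mulfVK ?subrr //.
  exact: lt0r_neq0.
have x_sq w : (x w *m (x w)^T) 0 0 <= 1.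
  rewrite {1}/x mulmxBl x_const subr0 -[_ *m _]trmxK trmx_mul trmxK mxE deltaE.
  by rewrite !mxE !eqxx gerBl invr_ge0 ltW.
have x_form : (x u *m A ^+ k *m (x v)^T) 0 0 = - (d%:R ^+ k / N).
  rewrite /x [(_ - c) *m _]mulmxBl (const_adjacency_exp e_sym e_reg).
  rewrite mulmxBl -/(x v).
  rewrite -scalemxAl x_const scaler0 subr0 linearB /= mulmxBr mxE deltaE.
  rewrite -rowE mxE A_uv add0r mxE; congr (- _).
  (* Transposing, with [A] symmetric, moves [A ^+ k] onto the constant vector, where it acts as
     [d ^ k]. *)
  rewrite -[_ *m _]trmxK trmx_mul trmxK tr_row trmx_exp A_sym.
  rewrite mxE colE -trmx_delta mulmxA (const_adjacency_exp e_sym e_reg).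
  by rewrite deltaE !mxE.
have bound : d%:R ^+ k / N <= lam ^+ k.
  have := sym_pow_form_bound (x := x u) (x v) k A_sym lam0.
  rewrite x_form normrN ger0_norm ?divr_ge0 ?exprn_ge0 ?ler0n ?(ltW N_gt0) //.
  move=> H; apply: le_trans (H _) _.
    (* Eigenvectors for [d] are constant by connectedness, hence orthogonal to [x u]; every other
       eigenvalue is bounded by [lam]. *)
    move=> mu w wA; have [mu_d|mu_d] := eqVneq mu d%:R.
      right; have [a ->] : exists a, w = const_mx a.
        by apply: (adjacency_eigen_const e_sym e_reg e_conn); rewrite -mu_d.
      exact: x_const.
    have [->|w0] := eqVneq w 0; first by right; rewrite mul0mx.
    by left; apply: eigA mu_d; apply/eigenvalueP; exists w.
  rewrite ler_piMr ?exprn_ge0 // ler_pdivrMr ?ltr0n // mul1r.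
  exact: lerD (x_sq u) (x_sq v).
by move: ltk; rewrite ltNge -ler_pdivrMr // bound.
Qed.

(** * Numerical estimates and the choice of the walk length *)

Lemma expR1_lt3 (R : realType) : expR 1 < 3 :> R.
Proof.
have le_expRN1 : (5 / 6) ^+ 6 <= expR (- 1) :> R.
  (* Six is the least [n] with [(1 - 1/n) ^ n > 1/3]. *)
  rewrite (_ : - 1 = - 6^-1 * 6%:R); last by field.
  have := expR_ge1Dx (- 6^-1 : R).
  by rewrite expRM_natr => ?; apply: lerXn2r; rewrite ?nnegrE ?expR_ge0 //; lra.
rewrite -[X in expR X]opprK expRN invf_plt ?posrE ?expR_gt0 //.
by apply: lt_le_trans le_expRN1; lra.
Qed.

Lemma ln_gt1 (R : realType) (N : nat) : (3 <= N)%N -> 1 < ln (N%:R : R).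
Proof.
move=> N3; have N0 : 0 < N%:R :> R by rewrite ltr0n (leq_trans _ N3).
rewrite -ltr_expR lnK ?posrE //; apply: lt_le_trans (expR1_lt3 R) _.
by rewrite ler_nat.
Qed.

Theorem corollary1 (R : realType) (V : finType) (e : rel V) (N d : nat)
  (e_sym : symmetric e) (e_irr : irreflexive e)
  (card_V : #|V| = N) (N_ge3 : (3 <= N)%N)
  (G_ram : ramanujan e R d)
  (G_curv : forall v : V, 0 <= resistance_curvature e R v)
  (d_large : 4 * (ln (N%:R : R)) `^ (2 / 3) <= d%:R) :
  (diam e)%:R <= 1 + 3 * ln (N%:R : R) / ln (ln (N%:R : R)).
Proof.
case: G_ram => e_conn e_reg e_eig.
have N_gt0 : 0 < N%:R :> R by rewrite ltr0n (leq_trans _ N_ge3).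
set L := ln (N%:R : R) in d_large *.
have L_gt1 : 1 < L by exact: ln_gt1.
have L_gt0 : 0 < L by exact: lt_trans L_gt1.
have lnL_gt0 : 0 < ln L by rewrite ln_gt0.
set t := 3 * L / ln L.
have t_ge0 : 0 <= t by rewrite divr_ge0 ?mulr_ge0 ?ltW.
(* [k] is the least integer strictly above [t]; this rounding accounts for the summand 1 in the
   bound. *)
have [k t_lt_k k_le] : exists2 k : nat, t < k%:R & k%:R <= 1 + t.
  have /andP[? ?] := truncn_itv t_ge0; exists (Num.truncn t).+1 => //.
  by rewrite -natr1 addrC lerD2l.
(* [r] is the cube root of [L], so [k > t] amounts to [r ^+ k > N]. *)
pose r : R := expR (ln L / 3).
have r_gt1 : 1 < r by rewrite -expR0 ltr_expR divr_gt0.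
have r_sq : L `^ (2 / 3) = r ^+ 2.
  by rewrite /powR gt_eqF // -expRM_natl; congr expR; field.
have N_lt : N%:R < r ^+ k.
  rewrite -expRM_natl -[N%:R]lnK ?posrE // ltr_expR -/L.
  by move: t_lt_k; rewrite /t ltr_pdivrMr // => ?; lra.
have d_ge : 4 * r ^+ 2 <= d%:R by rewrite -r_sq.
have r_sq_gt1 : 1 < r ^+ 2 by rewrite exprn_egt1.
have d_gt1 : 1 < d%:R :> R by lra.
set lam := 2 * Num.sqrt (d%:R - 1) in e_eig.
have lam_gt0 : 0 < lam by rewrite mulr_gt0 // sqrtr_gt0 subr_gt0.
have lam_r_ge0 : 0 <= lam * r by rewrite ltW // mulr_gt0 // expR_gt0.
(* After squaring: [4 (d - 1) r^2 <= (d - 1) d <= d^2]. *)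
have lam_r : lam * r <= d%:R.
  rewrite -(@ler_pXn2r _ 2) ?nnegrE //.
  rewrite exprMn /lam exprMn sqr_sqrtr; last by lra.
  have : (d%:R - 1) * (4 * r ^+ 2) <= (d%:R - 1) * d%:R :> R.
    by rewrite ler_wpM2l //; lra.
  by lra.
apply: (le_trans _ k_le).
rewrite ler_nat; apply: (diam_le e_sym e_conn e_reg (ltW lam_gt0) e_eig).
(* [lam^k N < (lam r)^k <= d^k], strict because [lam] is positive. *)
rewrite card_V; apply: (@lt_le_trans _ _ ((lam * r) ^+ k)).
  by rewrite [(lam * r) ^+ k]exprMn ltr_pM2l // exprn_gt0.
by rewrite lerXn2r ?nnegrE.
Qed.
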